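(* For every $\lambda\in\mathbb R^N$, with $\{\check\lambda_k,g_k^\lambda:1\le k\le K\}$, $G_k^\lambda$, $p^\lambda$, $\nu_k^\lambda$ as defined in the context, the following hold. (i) The log-likelihood ratio $L=\log(p^\lambda/p^0)$ can be expressed $$L(\vec x)=\sum_{k=1}^K\big\{\Delta_k(x_{k-1},s_k)+\check\lambda_k\mathcal Y(x_k)\big\}-G_1^\lambda(x_0),$$ where for each $k$ (with $x_k=(s_k,u_k)$) $\Delta_k(x_{k-1},s_k)=G_k^\lambda(x_{k-1})-g_k^\lambda(s_k)$. (ii) The relative entropy is given by $$D(p^\lambda\|p^0)=\sum_{k=1}^K\check\lambda_k\langle\nu_k^\lambda,\mathcal Y\rangle-\langle\nu_0^0,G_1^\lambda\rangle .$$ (iii) The value of the primal $J(p^\lambda,\nu_0^0):=D(p^\lambda\|p^0)+\frac\kappa2\sum_{n=1}^N\gamma_n^2$ is given by $$J(p^\lambda,\nu_0^0)=-\langle\nu_0^0,G_1^\lambda\rangle+\sum_{k=1}^K\check\lambda_k\langle\nu_k^\lambda,\mathcal Y\rangle+\frac\kappa2\sum_{n=1}^N\gamma_n^2,$$ with $\gamma_n=\langle p^\lambda,\hat{\mathcal Y}_n\rangle-\hat r_n$.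
   Context: $\mathsf S$ and $\mathsf U$ are finite sets and $\mathsf X=\mathsf S\times\mathsf U$; $\vec x=(x_0,\dots,x_K)\in\mathsf X^{K+1}$, $x_k=(s_k,u_k)$. Fix integers $K,N\ge1$, $\kappa>0$, $\mathcal Y:\mathsf X\to\mathbb R$, $r_1,\dots,r_K\in\mathbb R$, functions $w_n:\{0,\dots,K\}\to\mathbb R$ ($1\le n\le N$), $\hat r_n=\sum_{k=1}^Kw_n(k)r_k$, $\hat{\mathcal Y}_n(\vec x)=\sum_{k=1}^Kw_n(k)\mathcal Y(x_k)$, controlled transition matrices $T_k$ ($T_k(x,\cdot)$ a pmf on $\mathsf S$), an initial pmf $\nu_0^0$ on $\mathsf X$, and nominal randomized policies $\phi_k^0(u\mid s)$, $1\le k\le K$. A policy $\{\phi_k\}$ defines the pmf on $\mathsf X^{K+1}$ $$p(\vec x)=\nu_0^0(x_0)\prod_{k=0}^{K-1}T_k(x_k,s_{k+1})\phi_{k+1}(u_{k+1}\mid s_{k+1}),$$ with $k$th marginal $\nu_k$; $p^0$ is the pmf for $\{\phi_k^0\}$. For $\lambda\in\mathbb R^N$: $\check\lambda_k=\sum_{n=1}^N\lambda_nw_n(k)$; $g_{K+1}^\lambda\equiv0$ and, for $1\le k\le K$, $$g_k^\lambda(s)=\log\Big(\sum_u\phi_k^0(u\mid s)\exp\Big(\sum_{s'}T_k((s,u),s')g_{k+1}^\lambda(s')+\check\lambda_k\mathcal Y(s,u)\Big)\Big);$$ $G_k^\lambda(x)=\sum_sT_{k-1}(x,s)g_k^\lambda(s)$;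 and $p^\lambda$, with marginals $\nu_k^\lambda$, is the pmf defined by the policy $$\phi_k^\lambda(u\mid s)=\phi_k^0(u\mid s)\exp\Big(\sum_{s'}T_k((s,u),s')g_{k+1}^\lambda(s')+\check\lambda_k\mathcal Y(s,u)-g_k^\lambda(s)\Big).$$ $D(p\|p^0)=\sum_{\vec x}p(\vec x)\log(p(\vec x)/p^0(\vec x))$ is relative entropy, $\langle\cdot,\cdot\rangle$ denotes the sum of the pmf against the function, and the log-likelihood ratio is considered at points $\vec x$ where $p^0(\vec x)>0$. *)

(* Defs.v *)
From HB Require Import structures.
From mathcomp Require Import all_boot all_order all_algebra.
From mathcomp Require Import all_classical all_reals all_analysis.

Set Implicit Arguments.
Unset Strict Implicit.
Unset Printing Implicit Defensive.

Import Order.TTheory GRing.Theory Num.Theory.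

Local Open Scope ring_scope.

(* Time-indexed data (transition matrices T, policies phi, weights w, targets
   r, multipliers c) are functions of nat; only the values at the times used
   in the formulas (all at most K) matter. *)

Definition is_pmf (R : realType) (I : finType) (p : I -> R) : Prop :=
  (forall i, 0 <= p i) /\ \sum_i p i = 1.

Definition pairing (R : realType) (I : finType) (p f : I -> R) : R :=
  \sum_i p i * f i.

(* Terms with p i = 0 contribute 0, and p i * log (p i / 0) = +oo if p i > 0. *)
Definition rel_entropy (R : realType) (I : finType) (p q : I -> R) : \bar R :=
  (\sum_(i : I) if p i == 0%R then 0
                else if q i == 0%R then +oo
                else (p i * ln (p i / q i))%:E)%E.

Definition traj (S U : finType) (K : nat) : finType :=
  {ffun 'I_K.+1 -> S * U}.

(* The pair x_k = (s_k, u_k), meaningful for k <= K. *)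
Definition state (S U : finType) (K : nat) (x : traj S U K) (k : nat) : S * U :=
  x (inord k).

Definition traj_pmf (R : realType) (S U : finType) (K : nat)
    (nu : S * U -> R) (T : nat -> S * U -> S -> R) (phi : nat -> S -> U -> R)
    (x : traj S U K) : R :=
  nu (state x 0) *
  \prod_(0 <= k < K)
     (T k (state x k) (state x k.+1).1 *
      phi k.+1 (state x k.+1).1 (state x k.+1).2).

Definition marginal (R : realType) (S U : finType) (K : nat)
    (p : traj S U K -> R) (k : nat) (y : S * U) : R :=
  \sum_(x : traj S U K | state x k == y) p x.

Definition check_lambda (R : realType) (N : nat) (w : 'I_N -> nat -> R)
    (lam : 'rV[R]_N) (k : nat) : R :=
  \sum_(n < N) lam 0 n * w n k.

Definition g_step (R : realType) (S U : finType)
    (T : nat -> S * U -> S -> R) (phi0 : nat -> S -> U -> R) (Y : S * U -> R)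
    (c : nat -> R) (k : nat) (gnext : S -> R) (s : S) : R :=
  ln (\sum_(u : U) phi0 k s u *
        expR (\sum_(s' : S) T k (s, u) s' * gnext s' + c k * Y (s, u))).

(* g_back j is g_{K+1-j}. *)
Fixpoint g_back (R : realType) (S U : finType) (K : nat)
    (T : nat -> S * U -> S -> R) (phi0 : nat -> S -> U -> R) (Y : S * U -> R)
    (c : nat -> R) (j : nat) : S -> R :=
  if j is i.+1 then g_step T phi0 Y c (K - i) (g_back K T phi0 Y c i)
  else fun=> 0.

Definition g_fun (R : realType) (S U : finType) (K : nat)
    (T : nat -> S * U -> S -> R) (phi0 : nat -> S -> U -> R) (Y : S * U -> R)
    (c : nat -> R) (k : nat) : S -> R :=
  g_back K T phi0 Y c (K.+1 - k).

Lemma g_fun_last (R : realType) (S U : finType) (K : nat)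
    (T : nat -> S * U -> S -> R) (phi0 : nat -> S -> U -> R) (Y : S * U -> R)
    (c : nat -> R) (s : S) :
  g_fun K T phi0 Y c K.+1 s = 0.
Proof. by rewrite /g_fun subnn. Qed.

Lemma g_fun_rec (R : realType) (S U : finType) (K : nat)
    (T : nat -> S * U -> S -> R) (phi0 : nat -> S -> U -> R) (Y : S * U -> R)
    (c : nat -> R) (k : nat) (s : S) :
  (k <= K)%N ->
  g_fun K T phi0 Y c k s =
  ln (\sum_(u : U) phi0 k s u *
        expR (\sum_(s' : S) T k (s, u) s' * g_fun K T phi0 Y c k.+1 s'
              + c k * Y (s, u))).
Proof. by move=> lekK; rewrite /g_fun subSn //= subKn. Qed.

Definition G_fun (R : realType) (S U : finType) (K : nat)
    (T : nat -> S * U -> S -> R) (phi0 : nat -> S -> U -> R) (Y : S * U -> R)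
    (c : nat -> R) (k : nat) (x : S * U) : R :=
  \sum_(s : S) T k.-1 x s * g_fun K T phi0 Y c k s.

Definition tilted_policy (R : realType) (S U : finType) (K : nat)
    (T : nat -> S * U -> S -> R) (phi0 : nat -> S -> U -> R) (Y : S * U -> R)
    (c : nat -> R) (k : nat) (s : S) (u : U) : R :=
  phi0 k s u *
  expR (\sum_(s' : S) T k (s, u) s' * g_fun K T phi0 Y c k.+1 s'
        + c k * Y (s, u) - g_fun K T phi0 Y c k s).

Definition r_hat (R : realType) (K N : nat) (w : 'I_N -> nat -> R)
    (r : nat -> R) (n : 'I_N) : R :=
  \sum_(1 <= k < K.+1) w n k * r k.

Definition Y_hat (R : realType) (S U : finType) (K N : nat)
    (w : 'I_N -> nat -> R) (Y : S * U -> R) (n : 'I_N) (x : traj S U K) : R :=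
  \sum_(1 <= k < K.+1) w n k * Y (state x k).

Definition gamma_err (R : realType) (S U : finType) (K N : nat)
    (w : 'I_N -> nat -> R) (r : nat -> R) (Y : S * U -> R)
    (p : traj S U K -> R) (n : 'I_N) : R :=
  pairing p (Y_hat w Y n) - r_hat K w r n.

Definition primal (R : realType) (S U : finType) (K N : nat) (kappa : R)
    (T : nat -> S * U -> S -> R) (phi0 : nat -> S -> U -> R)
    (w : 'I_N -> nat -> R) (r : nat -> R) (Y : S * U -> R)
    (p : traj S U K -> R) (nu : S * U -> R) : \bar R :=
  (rel_entropy p (traj_pmf nu T phi0)
   + (kappa / 2 * \sum_(n < N) gamma_err w r Y p n ^+ 2)%:E)%E.

(* Main.v *)
Require Import Defs.
From HB Require Import structures.
From mathcomp Require Import all_boot all_order all_algebra.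
From mathcomp Require Import all_classical all_reals all_analysis.
From mathcomp Require Import ring.

Import Order.TTheory GRing.Theory Num.Theory.

(** The tilted and nominal laws share the initial pmf and the transition
    matrices, so the likelihood ratio of a trajectory is the product of the
    ratios [phi^lambda_k / phi^0_k], each an explicit exponential. Hence
    [p^lambda = p^0 * exp L] at every trajectory, and a shift of the time index
    brings [L] to the form (i) ([traj_pmf_tilted]).

    As [p^lambda] vanishes wherever [p^0] does, the relative entropy is finite
    and equals the mean of [L] under [p^lambda] ([rel_entropy_tilt]). In that
    mean each [Delta_k] contributes 0: it is the difference between [g_k(s_k)]
    and its conditional expectation given the past, a martingale increment,
    and this holds for any policy because the policy only acts after [s_k] is
    drawn ([pairing_martingale]). The terms in [Y] depend on [p^lambda] through
    its marginals only, and [G_1] is averaged against the initial pmf. All this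
    requires the tilted policy to be normalized, which is what the recursion
    defining [g_k] ensures ([tilted_policy_sum1]). Part (iii) is part (ii) with
    the quadratic penalty added. *)

Set Implicit Arguments.
Unset Strict Implicit.
Unset Printing Implicit Defensive.

Local Open Scope ring_scope.

(** * Expectations under a controlled Markov chain *)

Definition traj_rcons (S U : finType) (m : nat) (x : traj S U m) (y : S * U) :
    traj S U m.+1 :=
  [ffun i => if unlift ord_max i is Some j then x j else y].

Lemma state_rcons (S U : finType) (m : nat) (x : traj S U m) (y : S * U) k :
  (k <= m)%N -> state (traj_rcons x y) k = state x k.
Proof.
move=> lekm; rewrite /state ffunE.
have -> : inord k = lift ord_max (inord k : 'I_m.+1).
  by apply: ord_inj; rewrite lift_max !inordK // ltnS ltnW.
by rewrite liftK.
Qed.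

Lemma state_rcons_last (S U : finType) (m : nat) (x : traj S U m) (y : S * U) :
  state (traj_rcons x y) m.+1 = y.
Proof.
rewrite /state ffunE; have -> : inord m.+1 = ord_max :> 'I_m.+2.
  by apply: val_inj; rewrite /= inordK.
by rewrite unlift_none.
Qed.

Lemma sum_traj_rcons (R : realType) (S U : finType) (m : nat)
    (F : traj S U m.+1 -> R) :
  \sum_x F x = \sum_(x : traj S U m) \sum_(y : S * U) F (traj_rcons x y).
Proof.
rewrite pair_big (reindex (fun xy : traj S U m * (S * U) =>
  traj_rcons xy.1 xy.2)) //=.
exists (fun x : traj S U m.+1 => ([ffun j => x (lift ord_max j)], x ord_max)).
  move=> [x y] _ /=; congr (_, _); last by rewrite ffunE unlift_none.
  by apply/ffunP=> j; rewrite !ffunE liftK.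
move=> x _; apply/ffunP=> i; rewrite ffunE /=.
by case: unliftP => [j|] -> //; rewrite ffunE.
Qed.

Lemma pairing_rcons (R : realType) (S U : finType) (m : nat)
    (nu : S * U -> R) (T : nat -> S * U -> S -> R) (phi : nat -> S -> U -> R)
    (F : traj S U m.+1 -> R) :
  pairing (traj_pmf nu T phi) F =
  pairing (traj_pmf nu T phi : traj S U m -> R) (fun x =>
    \sum_y T m (state x m) y.1 * phi m.+1 y.1 y.2 * F (traj_rcons x y)).
Proof.
rewrite /pairing sum_traj_rcons; apply: eq_bigr => x _.
rewrite mulr_sumr; apply: eq_bigr => y _.
rewrite /traj_pmf big_nat_recr //= state_rcons_last !state_rcons // !mulrA.
do 4 congr (_ * _).
apply: eq_big_nat => k /andP[_ ltkm].
by rewrite !state_rcons // ltnW.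
Qed.

(** Only the law of [s_{k+1}] matters to a function of [s_{k+1}] alone: the
    input [u_{k+1}] is summed out first. *)
Lemma sum_step (R : realType) (S U : finType)
    (t : S -> R) (phi : S -> U -> R) (f : S -> R) :
  (forall s, \sum_u phi s u = 1) ->
  \sum_y t y.1 * phi y.1 y.2 * f y.1 = \sum_s t s * f s.
Proof.
move=> phi1.
rewrite -(pair_bigA _ (fun s u => t s * phi s u * f s)) /=.
apply: eq_bigr => s _.
by rewrite -mulr_suml -mulr_sumr phi1 mulr1.
Qed.

(** The law of the chain up to time [m] is the marginal of its law up to time
    [m.+1]: this lets statements about early times go by induction on the
    horizon. *)
Lemma pairing_restrict (R : realType) (S U : finType) (m : nat)
    (nu : S * U -> R) (T : nat -> S * U -> S -> R) (phi : nat -> S -> U -> R)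
    (F : traj S U m.+1 -> R) (F0 : traj S U m -> R) :
  (forall x, \sum_s T m x s = 1) -> (forall s, \sum_u phi m.+1 s u = 1) ->
  (forall x y, F (traj_rcons x y) = F0 x) ->
  pairing (traj_pmf nu T phi) F = pairing (traj_pmf nu T phi) F0.
Proof.
move=> T1 phi1 FE; rewrite pairing_rcons; apply: eq_bigr => x _; congr (_ * _).
under eq_bigr => y _ do rewrite FE.
rewrite (sum_step (T m (state x m)) (fun=> F0 x) phi1).
by rewrite -mulr_suml T1 mul1r.
Qed.

Lemma pairing_initial (R : realType) (S U : finType) (m : nat)
    (nu : S * U -> R) (T : nat -> S * U -> S -> R) (phi : nat -> S -> U -> R)
    (f : S * U -> R) :
  (forall k, (k < m)%N -> forall x, \sum_s T k x s = 1) ->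
  (forall k, (k < m)%N -> forall s, \sum_u phi k.+1 s u = 1) ->
  pairing (traj_pmf nu T phi) (fun x : traj S U m => f (state x 0)) =
  pairing nu f.
Proof.
elim: m => [|m IHm] T1 phi1.
  rewrite /pairing (reindex (fun y : S * U => [ffun=> y] : traj S U 0)) /=.
    apply: eq_bigr => y _.
    by rewrite /traj_pmf big_geq // mulr1 /state !ffunE.
  exists (fun x : traj S U 0 => x ord0) => [y _|x _]; first by rewrite ffunE.
  by apply/ffunP=> i; rewrite ffunE (ord1 i).
rewrite (pairing_restrict nu (F0 := fun x => f (state x 0))).
- by apply: IHm => k ltkm; [apply: T1 | apply: phi1]; apply: ltnW.
- exact: T1.
- exact: phi1.
- by move=> x y; rewrite state_rcons.
Qed.

(** Given the past, [s_{k+1}] has law [T k x_k] whatever the policy, because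
    the input [u_{k+1}] is drawn after it; hence these differences are
    martingale increments and average to zero. *)
Lemma pairing_martingale (R : realType) (S U : finType) (m : nat)
    (nu : S * U -> R) (T : nat -> S * U -> S -> R) (phi : nat -> S -> U -> R)
    (f : S -> R) (k : nat) :
  (forall k, (k < m)%N -> forall x, \sum_s T k x s = 1) ->
  (forall k, (k < m)%N -> forall s, \sum_u phi k.+1 s u = 1) ->
  (k < m)%N ->
  pairing (traj_pmf nu T phi) (fun x : traj S U m =>
    \sum_s T k (state x k) s * f s - f (state x k.+1).1) = 0.
Proof.
elim: m => [//|m IHm] T1 phi1; rewrite ltnS leq_eqVlt => /predU1P[->|ltkm].
  rewrite pairing_rcons /pairing big1 // => x _.
  under eq_bigr => y _ do rewrite state_rcons // state_rcons_last mulrBr.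
  set a := \sum_s T m (state x m) s * f s.
  rewrite sumrB (sum_step (T m (state x m)) (fun=> a) (phi1 m _)) //.
  rewrite (sum_step (T m (state x m)) f (phi1 m _)) //.
  by rewrite -mulr_suml T1 // mul1r subrr mulr0.
rewrite (pairing_restrict nu (F0 := fun x =>
  \sum_s T k (state x k) s * f s - f (state x k.+1).1)).
- by apply: IHm => // j ltjm; [apply: T1 | apply: phi1]; apply: ltnW.
- exact: T1.
- exact: phi1.
- by move=> x y; rewrite !state_rcons // ltnW.
Qed.

Lemma pairing_marginal (R : realType) (S U : finType) (K : nat)
    (p : traj S U K -> R) (k : nat) (f : S * U -> R) :
  pairing (marginal p k) f = pairing p (fun x => f (state x k)).
Proof.
rewrite /pairing [RHS](partition_big (fun x => state x k) predT) //=.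
apply: eq_bigr => y _; rewrite /marginal mulr_suml.
by apply: eq_bigr => x /eqP ->.
Qed.

(** * Relative entropy of an exponential tilt *)

(** An exponential tilt is absolutely continuous, so no term of the relative
    entropy is infinite. *)
Lemma rel_entropy_tilt (R : realType) (I : finType) (p q L : I -> R) :
  (forall i, p i = q i * expR (L i)) ->
  rel_entropy p q = (pairing p L)%:E.
Proof.
move=> pE; rewrite /rel_entropy /pairing -sumEFin; apply: eq_bigr => i _.
have [->|p0] := eqVneq (p i) 0; first by rewrite mul0r.
have q0 : q i != 0 by apply: contraNneq p0 => q0; rewrite pE q0 mul0r.
by rewrite (negPf q0); congr (_ * _)%:E; rewrite pE mulrC mulKf // expRK.
Qed.

(** * The tilted policy *)

(** The value function [g_k] is the log-normalizer of the tilted policy; the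
    partition function is positive because [phi0 k s] has mass somewhere. *)
Lemma tilted_policy_sum1 (R : realType) (S U : finType) (K : nat)
    (T : nat -> S * U -> S -> R) (phi0 : nat -> S -> U -> R) (Y : S * U -> R)
    (c : nat -> R) (k : nat) (s : S) :
  (k <= K)%N -> is_pmf (phi0 k s) ->
  \sum_u tilted_policy K T phi0 Y c k s u = 1.
Proof.
move=> lekK [phi_ge0 phi1]; rewrite /tilted_policy.
under eq_bigr => u _ do rewrite expRD mulrA.
rewrite -mulr_suml g_fun_rec //; set Z := \sum_u _.
suff Z_gt0 : 0 < Z by rewrite expRN lnK ?posrE // mulfV // gt_eqF.
have [u phi_u] : exists u, 0 < phi0 k s u.
  apply/existsP; apply/contraT; rewrite negb_exists => /forallP phi_le0.
  have /eqP := phi1; rewrite big1 ?(eq_sym 0) ?oner_eq0 // => u _.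
  by apply/eqP; rewrite eq_le phi_ge0 andbT leNgt.
rewrite /Z (bigD1 u) //= ltr_pwDl ?mulr_gt0 ?expR_gt0 //.
by apply: sumr_ge0 => v _; rewrite mulr_ge0 ?expR_ge0.
Qed.

Definition log_ratio (R : realType) (S U : finType) (K : nat)
    (T : nat -> S * U -> S -> R) (phi0 : nat -> S -> U -> R) (Y : S * U -> R)
    (c : nat -> R) (x : traj S U K) : R :=
  \sum_(1 <= k < K.+1)
     (G_fun K T phi0 Y c k (state x k.-1) - g_fun K T phi0 Y c k (state x k).1
      + c k * Y (state x k))
  - G_fun K T phi0 Y c 1 (state x 0).

(** The exponents of the tilted policy add up to
    [G_{k+1}(x_k) + c_k Y(x_k) - g_k(s_k)] summed over [k]. Replacing
    [G_{k+1}(x_k)] by [G_k(x_{k-1})] shifts the index of a telescoping sum,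
    which costs the boundary terms [G_1(x_0)] and [G_{K+1} = 0]. *)
Lemma traj_pmf_tilted (R : realType) (S U : finType) (K : nat)
    (nu : S * U -> R) (T : nat -> S * U -> S -> R) (phi0 : nat -> S -> U -> R)
    (Y : S * U -> R) (c : nat -> R) (x : traj S U K) :
  traj_pmf nu T (tilted_policy K T phi0 Y c) x =
  traj_pmf nu T phi0 x * expR (log_ratio T phi0 Y c x).
Proof.
set G := G_fun K T phi0 Y c; set g := g_fun K T phi0 Y c.
have -> : log_ratio T phi0 Y c x = \sum_(0 <= k < K)
    (G k.+2 (state x k.+1) + c k.+1 * Y (state x k.+1)
     - g k.+1 (state x k.+1).1).
  have GK : G K.+1 (state x K) = 0.
    by rewrite /G /G_fun big1 // => s _; rewrite g_fun_last mulr0.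
  have /eqP := telescope_sumr (fun k => G k.+1 (state x k)) (leq0n K).
  rewrite GK sub0r => /eqP tele.
  rewrite /log_ratio big_add1 /= -/G -tele -big_split /=.
  by apply: eq_bigr => k _; rewrite -/g; ring.
rewrite expR_sum /traj_pmf -mulrA -big_split /=; congr (_ * _).
apply: eq_bigr => k _; rewrite /tilted_policy -surjective_pairing.
by rewrite mulrA.
Qed.

Lemma pairing_log_ratio (R : realType) (S U : finType) (K : nat)
    (nu : S * U -> R) (T : nat -> S * U -> S -> R)
    (phi phi0 : nat -> S -> U -> R) (Y : S * U -> R) (c : nat -> R) :
  (forall k, (k < K)%N -> forall x, \sum_s T k x s = 1) ->
  (forall k, (k < K)%N -> forall s, \sum_u phi k.+1 s u = 1) ->
  let p : traj S U K -> R := traj_pmf nu T phi in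
  pairing p (log_ratio T phi0 Y c) =
  \sum_(1 <= k < K.+1) c k * pairing (marginal p k) Y
  - pairing nu (G_fun K T phi0 Y c 1).
Proof.
move=> T1 phi1 p; rewrite -(pairing_initial nu _ T1 phi1) -/p.
rewrite /pairing /log_ratio.
under eq_bigr => x _ do rewrite mulrBr mulr_sumr.
rewrite sumrB exchange_big /=; congr (_ - _).
rewrite !big_add1 /=; apply: eq_big_nat => k /andP[_ ltkK].
under eq_bigr => x _ do rewrite mulrDr.
rewrite big_split /= [X in X + _](pairing_martingale _ _ T1 phi1 ltkK) add0r.
rewrite -/(pairing (marginal p k.+1) Y) pairing_marginal mulr_sumr.
by apply: eq_bigr => x _; rewrite mulrCA.
Qed.

Theorem corollary2p3 (R : realType) (S U : finType) (K N : nat)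
    (hK : (1 <= K)%N) (hN : (1 <= N)%N)
    (kappa : R) (hkappa : 0 < kappa)
    (Y : S * U -> R) (r : nat -> R) (w : 'I_N -> nat -> R)
    (T : nat -> S * U -> S -> R)
    (hT : forall k, (k < K)%N -> forall x, is_pmf (T k x))
    (nu0 : S * U -> R) (hnu0 : is_pmf nu0)
    (phi0 : nat -> S -> U -> R)
    (hphi0 : forall k, (1 <= k <= K)%N -> forall s, is_pmf (phi0 k s))
    (lam : 'rV[R]_N) :
  let c := check_lambda w lam in
  let g := g_fun K T phi0 Y c in
  let G := G_fun K T phi0 Y c in
  let p0 : traj S U K -> R := traj_pmf nu0 T phi0 in
  let plam : traj S U K -> R :=
    traj_pmf nu0 T (tilted_policy K T phi0 Y c) in
  let nulam := marginal plam in
  let Delta (k : nat) (x : S * U) (s : S) := G k x - g k s in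
  [/\ (forall x : traj S U K, 0 < p0 x ->
         ln (plam x / p0 x) =
         \sum_(1 <= k < K.+1)
            (Delta k (state x k.-1) (state x k).1 + c k * Y (state x k))
         - G 1%N (state x 0)),
      rel_entropy plam p0 =
        (\sum_(1 <= k < K.+1) c k * pairing (nulam k) Y
         - pairing nu0 (G 1%N))%:E
    & primal kappa T phi0 w r Y plam nu0 =
        (- pairing nu0 (G 1%N)
         + \sum_(1 <= k < K.+1) c k * pairing (nulam k) Y
         + kappa / 2 *
           \sum_(n < N) (pairing plam (Y_hat w Y n) - r_hat K w r n) ^+ 2)%:E].
Proof.
move=> c g G p0 plam nulam Delta.
have T1 k : (k < K)%N -> forall x, \sum_s T k x s = 1.
  by move=> ltkK x; have [] := hT _ ltkK x.
have phi1 k : (k < K)%N ->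
    forall s, \sum_u tilted_policy K T phi0 Y c k.+1 s u = 1.
  by move=> ltkK s; apply: tilted_policy_sum1 => //; apply: hphi0.
have entropyE : rel_entropy plam p0 =
    (\sum_(1 <= k < K.+1) c k * pairing (nulam k) Y - pairing nu0 (G 1%N))%:E.
  rewrite (rel_entropy_tilt (L := log_ratio T phi0 Y c)).
    by rewrite (pairing_log_ratio nu0 phi0 Y c T1 phi1).
  by move=> x; exact: traj_pmf_tilted.
split => //.
- move=> x p0x_gt0.
  by rewrite /plam traj_pmf_tilted mulrC mulKf ?gt_eqF // expRK.
- by rewrite /primal entropyE -EFinD [in LHS]addrC [in RHS]addrC [- _ + _]addrC.
Qed.
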